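(* Let $G$ be a graph on $\{1,\dots,n\}$ and let $\mathbf c$ be a relative interior regular point of a fixed hull and contact class $X=\mathcal F\cap\mathcal C(G)$. Then the following are equivalent: (i) $\mathbf c$ is class critical, that is, $D\operatorname{Per}(\mathbf c)[\delta\mathbf c]=0$ for every $\delta\mathbf c\in\mathbf{Roll}(\mathbf c)$; (ii) $\nabla\widetilde{\operatorname{Per}}(\mathbf c)\perp\mathbf{Roll}(\mathbf c)$; (iii) there exists a multiplier vector $\lambda=(\lambda_{ij})_{\{i,j\}\in E(G)}$ such that $\nabla\widetilde{\operatorname{Per}}(\mathbf c)=A(\mathbf c)^\top\lambda$; equivalently, with $h_{ij}(\mathbf d)=\|\mathbf d_j-\mathbf d_i\|-2$, one has $\nabla\widetilde{\operatorname{Per}}(\mathbf c)=\sum_{\{i,j\}\in E(G)}\lambda_{ij}\nabla h_{ij}(\mathbf c)$.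
   Context: $\mathcal D_n=\{\mathbf c\in(\mathbb R^2)^n:\|\mathbf c_i-\mathbf c_j\|\ge2\ \forall i\ne j\}$. For $\mathbf c\in\mathcal D_n$, $P(\mathbf c)=\operatorname{conv}\{\mathbf c_1,\dots,\mathbf c_n\}$ is the centre hull and $\operatorname{Per}(\mathbf c)$ is the length of the boundary of the convex hull of the union of the closed unit disks centred at $\mathbf c_1,\dots,\mathbf c_n$ (equal to $\operatorname{Per}(P(\mathbf c))+2\pi$). For a graph $G$ on $\{1,\dots,n\}$ with edge set $E(G)$: $\mathcal C(G)$ is the set of $\mathbf c\in\mathcal D_n$ with $\|\mathbf c_i-\mathbf c_j\|=2$ exactly for $\{i,j\}\in E(G)$ (and $>2$ for non-edges); $M(G)=\{\mathbf d\in(\mathbb R^2)^n:\|\mathbf d_i-\mathbf d_j\|=2\ \forall\{i,j\}\in E(G)\}$; $\mathbf d\in M(G)$ is regular for $G$ if the gradients at $\mathbf d$ of $g_{ij}(\mathbf d)=\|\mathbf d_j-\mathbf d_i\|^2-4$, $\{i,j\}\in E(G)$, are linearly independent. $\mathbf c$ is hull stable if all configurations of $\mathcal D_n$ in some neighbourhood of $\mathbf c$ have a centre hull with the same set of hull vertex indices and the same cyclic order as $P(\mathbf c)$. For hull stable $\mathbf c\in\mathcal C(G)$ regular for $G$, let $\mathcal F$ be the set of configurations whose centre hull has the same hull vertex set and cyclic order as $P(\mathbf c)$, and let $\mathcal B$ be the list of oriented hull edges in cyclic order. A fixed hull and contact class is a set $X=\mathcal F\cap\mathcal C(G)$ of this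 form. A point $\mathbf c\in X$ is a relative interior regular point if it is regular for $G$ and there is an open neighbourhood $U_0$ of $\mathbf c$ in $(\mathbb R^2)^n$ with $\|\mathbf d_i-\mathbf d_j\|>2$ for all $\mathbf d\in U_0\cap M(G)$ and all $\{i,j\}\notin E(G)$, and $U_0\cap\mathcal D_n\subset\mathcal F$ (so that $X\cap U_0=M(G)\cap U_0$). $\widetilde{\operatorname{Per}}(\mathbf d)=\sum_{(i,j)\in\mathcal B}\|\mathbf d_j-\mathbf d_i\|+2\pi$, which is smooth near $\mathbf c$ and equals $\operatorname{Per}$ on $\mathcal F$; $D\operatorname{Per}(\mathbf c)$ denotes $D\widetilde{\operatorname{Per}}(\mathbf c)$. For $\{i,j\}\in E(G)$, $\mathbf u_{ij}=(\mathbf c_j-\mathbf c_i)/\|\mathbf c_j-\mathbf c_i\|$. The contact operator $A(\mathbf c):(\mathbb R^2)^n\to\mathbb R^{E(G)}$ is $(A(\mathbf c)\delta\mathbf c)_{ij}=\langle\mathbf u_{ij},\delta\mathbf c_j-\delta\mathbf c_i\rangle$, and the rolling space is $\mathbf{Roll}(\mathbf c)=\ker A(\mathbf c)$. Gradients and orthogonality use the standard inner product. *)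

(* Defs.v *)
From HB Require Import structures.
From mathcomp Require Import all_boot all_order all_algebra.
From mathcomp Require Import all_classical all_reals all_analysis.

Set Implicit Arguments.
Unset Strict Implicit.
Unset Printing Implicit Defensive.

Import Order.TTheory GRing.Theory Num.Theory.
Import numFieldNormedType.Exports.

Local Open Scope classical_set_scope.
Local Open Scope ring_scope.

(* A configuration of n planar centres is a matrix d : 'M[R]_(n, 2) whose i-th
   row is the i-th centre.  The indices 1, ..., n become the elements of 'I_n. *)

Section Euclidean.
Variable R : realType.

(* MathComp-Analysis norms matrices by the maximum of the entries, hence an
   explicit Euclidean structure.  Neighbourhoods and derivatives are those of
   the library; the two norms are equivalent. *)
Definition inner (m n : nat) (x y : 'M[R]_(m, n)) : R :=
  \sum_i \sum_k x i k * y i k.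

Definition enorm (m n : nat) (x : 'M[R]_(m, n)) : R := Num.sqrt (inner x x).

Definition grad (m n : nat) (f : 'M[R]_(m, n) -> R) (x : 'M[R]_(m, n)) :
    'M[R]_(m, n) :=
  \matrix_(i, k) 'D_(delta_mx i k) f x.

(* The transpose, for the standard inner products, of a linear map into R^E:
   its ((i, k), a) entry is the (a, (i, k)) entry of L. *)
Definition transpose (m n : nat) (E : finType)
    (L : 'M[R]_(m, n) -> {ffun E -> R}) (l : {ffun E -> R}) : 'M[R]_(m, n) :=
  \matrix_(i, k) \sum_a L (delta_mx i k) a * l a.

Definition det2 (x y : 'rV[R]_2) : R :=
  x ord0 ord0 * y ord0 ord_max - x ord0 ord_max * y ord0 ord0.

End Euclidean.

(* A graph is a symmetric irreflexive relation e on 'I_n; each edge {i, j} is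
   represented by its ordered pair with i < j. *)
Definition edge (n : nat) (e : rel 'I_n) : finType :=
  {p : 'I_n * 'I_n | (p.1 < p.2)%N && e p.1 p.2}.

Definition src (n : nat) (e : rel 'I_n) (a : edge e) : 'I_n := (val a).1.
Definition tgt (n : nat) (e : rel 'I_n) (a : edge e) : 'I_n := (val a).2.

Section Configurations.
Variables (R : realType) (n : nat).
Implicit Types (c d : 'M[R]_(n, 2)) (e : rel 'I_n) (s : seq 'I_n).

Definition disp d (i j : 'I_n) : 'rV[R]_2 := row j d - row i d.

(* \mathcal D_n *)
Definition admissible : set 'M[R]_(n, 2) :=
  [set d | forall i j, i != j -> 2 <= enorm (disp d i j)].

(* \mathcal C(G) *)
Definition contact_class e : set 'M[R]_(n, 2) :=
  [set d | admissible d /\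
    forall i j, i != j ->
      if e i j then enorm (disp d i j) = 2 else 2 < enorm (disp d i j)].

(* M(G) *)
Definition linkage_space e : set 'M[R]_(n, 2) :=
  [set d | forall i j, e i j -> enorm (disp d i j) = 2].

Definition sq_constraint e (a : edge e) d : R :=
  enorm (disp d (src a) (tgt a)) ^+ 2 - 4.

Definition regular e d : Prop :=
  free [seq grad (sq_constraint a) d | a <- enum (edge e)].

Definition centre_hull d : set 'rV[R]_2 :=
  [set x | exists t : 'I_n -> R,
    [/\ forall i, 0 <= t i, \sum_i t i = 1 & x = \sum_i t i *: row i d]].

Definition hull_vertex d (i : 'I_n) : Prop :=
  forall (x y : 'rV[R]_2) (t : R),
    centre_hull d x -> centre_hull d y -> 0 < t < 1 ->
    row i d = t *: x + (1 - t) *: y -> x = row i d /\ y = row i d.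

(* The hull lies to the left of the side from i to j, so sides are oriented
   counterclockwise.  When the hull is a segment, both orientations of this
   segment are sides. *)
Definition hull_edge d (i j : 'I_n) : Prop :=
  [/\ i != j, hull_vertex d i, hull_vertex d j
    & forall x, centre_hull d x -> 0 <= det2 (disp d i j) (x - row i d)].

(* The pairs of cyclically consecutive entries of s; there is none when s is a
   singleton, in accordance with a one-point hull. *)
Definition cyclic_pairs s : seq ('I_n * 'I_n) :=
  [seq (i, next s i) | i <- s & next s i != i].

(* s lists the hull vertices of d without repetition, counterclockwise; this
   determines s up to rotation, and \mathcal B is then cyclic_pairs s. *)
Definition hull_order d s : Prop :=
  [/\ uniq s, forall i, i \in s <-> hull_vertex d i
    & forall p, p \in cyclic_pairs s -> hull_edge d p.1 p.2].

Definition same_hull c d : Prop := exists s, hull_order c s /\ hull_order d s.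

Definition hull_stable c : Prop :=
  \forall d \near c, admissible d -> same_hull c d.

(* \mathcal F, for the hull of c *)
Definition hull_class c : set 'M[R]_(n, 2) :=
  [set d | admissible d /\ same_hull c d].

(* X = \mathcal F `&` \mathcal C(G), where the hull stable configuration c0,
   regular for G, fixes \mathcal F *)
Definition fixed_class e c0 (X : set 'M[R]_(n, 2)) : Prop :=
  [/\ hull_stable c0, contact_class e c0, regular e c0
    & X = hull_class c0 `&` contact_class e].

Definition relint_regular e c0 (X : set 'M[R]_(n, 2)) c : Prop :=
  [/\ X c, regular e c
    & exists U0 : set 'M[R]_(n, 2),
      [/\ open U0, U0 c,
          forall d, U0 d -> linkage_space e d ->
            forall i j, i != j -> ~~ e i j -> 2 < enorm (disp d i j)
        & U0 `&` admissible `<=` hull_class c0]].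

(* \widetilde{Per}, for \mathcal B = cyclic_pairs s *)
Definition per_tilde s d : R :=
  \sum_(p <- cyclic_pairs s) enorm (disp d p.1 p.2) + 2 * pi.

Definition udir c (i j : 'I_n) : 'rV[R]_2 :=
  (enorm (disp c i j))^-1 *: disp c i j.

Definition contact_op e c (v : 'M[R]_(n, 2)) : {ffun edge e -> R} :=
  [ffun a => inner (udir c (src a) (tgt a)) (disp v (src a) (tgt a))].

Definition roll e c : set 'M[R]_(n, 2) :=
  [set v | contact_op e c v = 0].

Definition class_critical e s c : Prop :=
  forall v, roll e c v -> 'd (per_tilde s) c v = 0.

Definition gap e (a : edge e) d : R := enorm (disp d (src a) (tgt a)) - 2.

End Configurations.

(* Main.v *)
(** Distinct centres of an admissible configuration are at distance at least 2,
    so [per_tilde] and the gaps are differentiable at [c], and the differential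
    of the gap at the edge [a] is the [a]-th component of the contact operator.
    Hence [roll e c] is the common orthogonal complement of the gradients of
    the gaps, and a vector is orthogonal to it if and only if it lies in their
    span. *)
Require Import Defs.
From HB Require Import structures.
From mathcomp Require Import all_boot all_order all_algebra.
From mathcomp Require Import all_classical all_reals all_analysis.
From mathcomp Require Import ring.

Import Order.TTheory GRing.Theory Num.Theory.
Import numFieldNormedType.Exports.

Local Open Scope classical_set_scope.
Local Open Scope ring_scope.

Section InnerProduct.
Context {R : realType} {m n : nat}.
Implicit Types x y z : 'M[R]_(m, n).

Lemma innerC x y : inner x y = inner y x.
Proof.
by rewrite /inner; apply: eq_bigr => i _; apply: eq_bigr => k _; rewrite mulrC.
Qed.

Lemma innerDr x y z : inner x (y + z) = inner x y + inner x z.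
Proof.
rewrite /inner -big_split; apply: eq_bigr => i _.
by rewrite -big_split; apply: eq_bigr => k _; rewrite mxE mulrDr.
Qed.

Lemma innerZr a x y : inner x (a *: y) = a * inner x y.
Proof.
rewrite /inner mulr_sumr; apply: eq_bigr => i _.
by rewrite mulr_sumr; apply: eq_bigr => k _; rewrite mxE mulrCA.
Qed.

Lemma inner0r x : inner x 0 = 0.
Proof. by rewrite -(scale0r (0 : 'M[R]_(m, n))) innerZr mul0r. Qed.

Lemma inner_suml (I : Type) (r : seq I) (F : I -> 'M[R]_(m, n)) y :
  inner (\sum_(a <- r) F a) y = \sum_(a <- r) inner (F a) y.
Proof.
rewrite innerC (big_morph _ (innerDr y) (inner0r y)).
by apply: eq_bigr => a _; rewrite innerC.
Qed.

(** Flattening matrices into rows turns [inner] into a matrix product, so that orthogonality can be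
    handled by row-space algebra. *)
Lemma mxvec_inner x y : mxvec x *m (mxvec y)^T = (inner x y)%:M.
Proof.
rewrite [LHS]mx11_scalar mxE; congr (_%:M).
rewrite (reindex _ (curry_mxvec_bij m n)) /=.
rewrite /inner (pair_bigA _ (fun i k => x i k * y i k)) /=.
by apply: eq_bigr => -[i k] _; rewrite mxE !mxvecE.
Qed.

(** The row space of [G] consists of the rows annihilated by [cokermx G]. Each column of
    [cokermx G], reshaped as a matrix, is orthogonal to every [g a], so the hypothesis makes it
    orthogonal to [x] as well. *)
Lemma orthogonal_span (E : finType) (g : E -> 'M[R]_(m, n)) x :
  (forall v, (forall a, inner (g a) v = 0) -> inner x v = 0) ->
  exists l : {ffun E -> R}, x = \sum_a l a *: g a.
Proof.
move=> gx; pose G := \matrix_(k < #|E|) mxvec (g (enum_val k)).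
have /submxP[D xD] : (mxvec x <= G)%MS.
  rewrite submxE; apply/eqP/matrixP => i j; rewrite ord1 mxE.
  pose v : 'M[R]_(m, n) := vec_mx (cokermx G *m delta_mx j (0 : 'I_1))^T.
  have vE : (mxvec v)^T = cokermx G *m delta_mx j 0 by rewrite vec_mxK trmxK.
  have gv a : inner (g a) v = 0.
    have : row (enum_rank a) (G *m (mxvec v)^T) = 0.
      by rewrite vE mulmxA mulmx_coker mul0mx row0.
    rewrite row_mul rowK enum_rankK mxvec_inner => /matrixP/(_ 0 0).
    by rewrite !mxE mulr1n.
  have := mxvec_inner x v; rewrite gx // vE mulmxA -colE => /matrixP/(_ 0 0).
  by rewrite !mxE mul0rn.
exists [ffun a => D 0 (enum_rank a)].
apply: (can_inj mxvecK); rewrite xD mulmx_sum_row linear_sum /=.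
rewrite (reindex _ (onW_bij _ (enum_rank_bij E))) /=.
by apply: eq_bigr => a _; rewrite ffunE linearZ rowK enum_rankK.
Qed.

(** Expand [v] in the basis [delta_mx i k], on which the differential takes the entries of
    [grad f x] as values. *)
Lemma diff_inner_grad (f : 'M[R]_(m, n) -> R) x v :
  differentiable f x -> 'd f x v = inner (grad f x) v.
Proof.
move=> df; rewrite {1}[v]matrix_sum_delta linear_sum; apply: eq_bigr => i _.
rewrite linear_sum; apply: eq_bigr => k _.
by rewrite linearZ mxE deriveE // mulrC.
Qed.

Lemma is_diff_coord x i k :
  is_diff x (fun y : 'M[R]_(m, n) => y i k : R) (fun y => y i k : R).
Proof.
apply: DiffDef; first exact: differentiable_coord.
have lin : linear (fun y : 'M[R]_(m, n) => y i k : R^o).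
  by move=> a y z; rewrite !mxE.
(* Once bundled as a linear map, the coordinate is its own differential, because it is
   continuous. *)
pose f : {linear 'M[R]_(m, n) -> R^o} := HB.pack (fun y : 'M[R]_(m, n) => y i k)
  (GRing.isLinear.Build _ _ _ _ _ lin).
exact: (@diff_lin _ _ _ f x (@coord_continuous _ _ _ i k)).
Qed.

End InnerProduct.

Lemma is_diff_sqrt (R : realType) (x : R) :
  0 < x -> is_diff x Num.sqrt ( *:%R^~ (2 * Num.sqrt x)^-1 : R -> R).
Proof.
move=> x0; have [dx Dx] := is_derive1_sqrt x0.
have df : differentiable (Num.sqrt : R -> R) x by apply/derivable1_diffP.
apply: DiffDef => //; apply/funext => t.
(* A linear map on [R] is determined by its value at 1, here the derivative. *)
by rewrite -{1}[t]mulr1 linearZ -Dx deriveE.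
Qed.

Section Gradients.
Context {R : realType} {n : nat}.
Implicit Types (c d v : 'M[R]_(n, 2)) (i j : 'I_n) (e : rel 'I_n).

Lemma enorm_dispE d i j : enorm (disp d i j) =
  Num.sqrt ((d j 0 - d i 0) ^+ 2 + (d j 1 - d i 1) ^+ 2).
Proof.
rewrite /enorm /inner big_ord1 big_ord_recl big_ord1 !mxE !expr2.
by rewrite (_ : lift ord0 0 = 1) //; apply: val_inj.
Qed.

(** Chain rule: the factor 2 from the squares cancels the one in the derivative of the root, which
    leaves the unit direction. Positivity keeps the root away from its singularity at 0. *)
Lemma is_diff_enorm_disp c i j : 0 < enorm (disp c i j) ->
  is_diff c (fun d => enorm (disp d i j))
            (fun v => inner (udir c i j) (disp v i j)).
Proof.
rewrite enorm_dispE sqrtr_gt0 => c0.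
rewrite (_ : (fun d => _) = Num.sqrt \o
  (fun d => (d j 0 - d i 0) ^+ 2 + (d j 1 - d i 1) ^+ 2)); last first.
  by apply/funext => d; rewrite enorm_dispE.
(* The argument 1 yields the exponent 2, since [is_diffX] treats the successor power. *)
have dk k := is_diffX 1
  (is_diffB (is_diff_coord c j k) (is_diff_coord c i k)).
apply: (is_diff_eq
  (is_diff_comp (is_diffD (dk 0) (dk 1)) (is_diff_sqrt _ _ c0))).
apply/funext => v; rewrite /inner big_ord1 big_ord_recl big_ord1 !mxE.
rewrite (_ : lift ord0 0 = 1) //; last exact: val_inj.
rewrite enorm_dispE /= !fctE /GRing.scale /=.
by field; rewrite gt_eqF // sqrtr_gt0.
Qed.

Lemma differentiable_per_tilde c (s : seq 'I_n) :
  admissible c -> differentiable (per_tilde s) c.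
Proof.
move=> cD; rewrite (_ : per_tilde s =
  \sum_(p <- cyclic_pairs s) (fun d => enorm (disp d p.1 p.2)) + cst (2 * pi));
  last by apply/funext => d; rewrite /per_tilde fctE fct_sumE.
apply: differentiableD; last exact: differentiable_cst.
(* Membership in [cyclic_pairs s] is kept because its filter makes the two endpoints distinct;
   admissibility then gives a positive length. *)
rewrite big_seq; elim/big_ind: _ => [|f g df dg|p].
- exact: (differentiable_cst (0 : R) c).
- exact: differentiableD.
case/mapP => i; rewrite mem_filter => /andP[ni _] ->.
have c0 : 0 < enorm (disp c i (next s i)).
  by rewrite (lt_le_trans _ (cD _ _ _)) // eq_sym.
by have [] := is_diff_enorm_disp c i (next s i) c0.
Qed.

Lemma is_diff_gap c e (a : edge e) : admissible c ->
  is_diff c (gap a) (fun v => contact_op e c v a).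
Proof.
move=> cD; have ne : src a != tgt a.
  by rewrite neq_ltn; have /andP[->] := valP a.
have c0 : 0 < enorm (disp c (src a) (tgt a)).
  by rewrite (lt_le_trans _ (cD _ _ ne)).
have D := is_diffB (is_diff_enorm_disp _ _ _ c0) (is_diff_cst (2 : R) c).
apply: (is_diff_eq D).
by apply/funext => v; rewrite fctE subr0 ffunE.
Qed.

Lemma contact_op_grad c e (a : edge e) v : admissible c ->
  contact_op e c v a = inner (grad (gap a) c) v.
Proof.
move=> cD; have dg := is_diff_gap c e a cD.
by rewrite -diff_inner_grad // diff_val.
Qed.

(** The contact operator applied to [delta_mx i k] lists the derivatives of the gaps in that
    direction, that is, the [(i, k)] entries of their gradients. *)
Lemma transpose_contact_op c e (l : {ffun edge e -> R}) : admissible c ->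
  transpose (contact_op e c) l = \sum_a l a *: grad (gap a) c.
Proof.
move=> cD; apply/matrixP => i k; rewrite mxE summxE.
apply: eq_bigr => a _; have dg := is_diff_gap c e a cD.
by rewrite 2!mxE deriveE // diff_val mulrC.
Qed.

End Gradients.

Theorem proposition3p8 (R : realType) (n : nat) (e : rel 'I_n)
    (e_sym : symmetric e) (e_irr : irreflexive e)
    (c0 : 'M[R]_(n, 2)) (s : seq 'I_n) (X : set 'M[R]_(n, 2))
    (hX : fixed_class e c0 X) (hs : hull_order c0 s)
    (c : 'M[R]_(n, 2)) (hc : relint_regular e c0 X c) :
  [<-> class_critical e s c;
       forall v, roll e c v -> inner (grad (per_tilde s) c) v = 0;
       exists l : {ffun edge e -> R},
         grad (per_tilde s) c = transpose (contact_op e c) l;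
       exists l : {ffun edge e -> R},
         grad (per_tilde s) c = \sum_a l a *: grad (gap a) c]
  /\ (forall l : {ffun edge e -> R},
        grad (per_tilde s) c = transpose (contact_op e c) l <->
        grad (per_tilde s) c = \sum_a l a *: grad (gap a) c).
Proof.
have cD : admissible c.
  by case: hc hX => Xc _ _ [_ _ _ XE]; move: Xc; rewrite XE => -[[]].
have dper := differentiable_per_tilde c s cD.
split; last by move=> l; rewrite transpose_contact_op.
tfae.
- by move=> crit v /crit; rewrite diff_inner_grad.
(* A vector orthogonal to every gap gradient is rolling, hence orthogonal to the perimeter gradient
   by [orth]; [orthogonal_span] then supplies the multipliers. *)
- move=> orth; have [v gv|l ->] := orthogonal_span _
    (fun a : edge e => grad (gap a) c) (grad (per_tilde s) c);
    last by exists l; rewrite transpose_contact_op.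
  by apply: orth; apply/ffunP => a; rewrite contact_op_grad // gv ffunE.
- by move=> [l ->]; exists l; rewrite transpose_contact_op.
(* This closes the cycle: a rolling vector is orthogonal to each gap gradient, so the sum vanishes
   term by term. *)
- move=> [l perE] v /ffunP rv; rewrite diff_inner_grad // perE inner_suml.
  rewrite big1 // => a _; rewrite innerC innerZr innerC -contact_op_grad //.
  by rewrite rv ffunE mulr0.
Qed.
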